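(* Let $A\in\mathbb{R}^{n\times n}$ be an irreducible nonsingular $M$-matrix, let $\mathbf{a}\in\mathbb{R}^n$ with $\mathbf{a}>0$, and let $\Gamma>0$. Let $\{(\mathbf{u}_k,\lambda_k)\}_{k\ge 0}$ be generated by the Newton-Noda iteration (described in the context) from a vector $\mathbf{u}_0>0$ with $\|\mathbf{u}_0\|=1$. If $\theta_k\in(0,1]$ for all $k$, then $\mathbf{u}_k>0$ for all $k$.
   Context: Inequalities between vectors or matrices are entrywise; $\|\cdot\|$ is the 2-norm; $\mathbf{v}^{[m]}$ denotes the entrywise power and quotients of vectors are entrywise; $\mathbf{e}=[1,\dots,1]^T$; $\min(\mathbf{w}/\mathbf{v})=\min_i w_i/v_i$. A $Z$-matrix is a real square matrix with nonpositive off-diagonal entries; an $M$-matrix is a (nonsingular) $Z$-matrix $A$ with $A^{-1}\ge 0$. $A$ is irreducible if there is no nonempty proper subset $S\subset\{1,\dots,n\}$ with $A_{ij}=0$ for all $i\in S$, $j\notin S$. For $\mathbf{u}\in\mathbb{R}^n$, $\lambda\in\mathbb{R}$ put $$\mathcal{A}(\mathbf{u})=A+\Gamma\,\mathrm{diag}\Big(\mathbf{e}-\frac{\mathbf{e}}{\mathbf{a}+\mathbf{u}^{[2]}}\Big),\quad \mathbf{r}(\mathbf{u},\lambda)=\mathcal{A}(\mathbf{u})\mathbf{u}-\lambda\mathbf{u},$$ $$J(\mathbf{u},\lambda)=A+(\Gamma-\lambda)I-\Gamma\,\mathrm{diag}\Big(\frac{\mathbf{a}-\mathbf{u}^{[2]}}{(\mathbf{a}+\mathbf{u}^{[2]})^{[2]}}\Big).$$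 Newton-Noda iteration (run without a stopping test): given $\mathbf{u}_0>0$ with $\|\mathbf{u}_0\|=1$, set $\lambda_0=\min\big(\mathcal{A}(\mathbf{u}_0)\mathbf{u}_0/\mathbf{u}_0\big)$. For $k=0,1,2,\dots$: let $(\Delta_k,\delta_k)\in\mathbb{R}^n\times\mathbb{R}$ solve $$\begin{bmatrix}J(\mathbf{u}_k,\lambda_k)&-\mathbf{u}_k\\-\mathbf{u}_k^T&0\end{bmatrix}\begin{bmatrix}\Delta_k\\ \delta_k\end{bmatrix}=-\begin{bmatrix}\mathbf{r}(\mathbf{u}_k,\lambda_k)\\ \tfrac12(1-\mathbf{u}_k^T\mathbf{u}_k)\end{bmatrix}$$ (when $\mathbf{u}_k>0$ this system is uniquely solvable); choose a scalar $\theta_k>0$; set $\mathbf{w}_{k+1}=\mathbf{u}_k+\theta_k\Delta_k$, $\mathbf{u}_{k+1}=\mathbf{w}_{k+1}/\|\mathbf{w}_{k+1}\|$, and $\lambda_{k+1}=\min\big(\mathcal{A}(\mathbf{u}_{k+1})\mathbf{u}_{k+1}/\mathbf{u}_{k+1}\big)$. *)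

(* Defs.v *)
From mathcomp Require Import all_boot all_order all_algebra.
From mathcomp Require Import reals.
Set Implicit Arguments.
Unset Strict Implicit.
Unset Printing Implicit Defensive.
Import Order.TTheory GRing.Theory Num.Theory.
Local Open Scope ring_scope.

(* Vectors of R^n are column vectors; vector and matrix inequalities are
   entrywise. *)
Definition mx_gt0 (R : realType) m n (M : 'M[R]_(m, n)) : Prop :=
  forall i j, 0 < M i j.

Definition mx_ge0 (R : realType) m n (M : 'M[R]_(m, n)) : Prop :=
  forall i j, 0 <= M i j.

Definition Z_matrix (R : realType) n (A : 'M[R]_n) : Prop :=
  forall i j, i != j -> A i j <= 0.

Definition nonsingular_M_matrix (R : realType) n (A : 'M[R]_n) : Prop :=
  [/\ Z_matrix A, A \in unitmx & mx_ge0 (invmx A)].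

Definition irreducible_mx (R : realType) n (A : 'M[R]_n) : Prop :=
  ~ exists S : {set 'I_n},
      [/\ S != set0, S != setT &
          forall i j, i \in S -> j \notin S -> A i j = 0].

Definition norm2 (R : realType) n (v : 'cV[R]_n) : R :=
  Num.sqrt (\sum_i v i 0 ^+ 2).

Definition vpow (R : realType) n (v : 'cV[R]_n) (m : nat) : 'cV[R]_n :=
  map_mx (fun x => x ^+ m) v.

Definition vquot (R : realType) n (w v : 'cV[R]_n) : 'cV[R]_n :=
  map2_mx (fun x y => x / y) w v.

(* Starting the fold at an entry of v makes this the genuine minimum, since
   Num.min is idempotent. *)
Definition vmin (R : realType) n (v : 'cV[R]_n.+1) : R :=
  \big[Num.min/v 0 0]_i v i 0.

(* diag_mx expects a row vector, hence the transposes. *)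
Definition calA (R : realType) n (A : 'M[R]_n) (a : 'cV[R]_n) (Gamma : R)
    (u : 'cV[R]_n) : 'M[R]_n :=
  let e := const_mx 1 in
  A + Gamma *: diag_mx (e - vquot e (a + vpow u 2))^T.

Definition residual (R : realType) n (A : 'M[R]_n) (a : 'cV[R]_n) (Gamma : R)
    (u : 'cV[R]_n) (lambda : R) : 'cV[R]_n :=
  calA A a Gamma u *m u - lambda *: u.

Definition jacobian (R : realType) n (A : 'M[R]_n) (a : 'cV[R]_n) (Gamma : R)
    (u : 'cV[R]_n) (lambda : R) : 'M[R]_n :=
  A + (Gamma - lambda)%:M
    - Gamma *: diag_mx (vquot (a - vpow u 2) (vpow (a + vpow u 2) 2))^T.

Definition newton_system (R : realType) n (A : 'M[R]_n) (a : 'cV[R]_n)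
    (Gamma : R) (u : 'cV[R]_n) (lambda : R)
    (Delta : 'cV[R]_n) (delta : R) : Prop :=
  block_mx (jacobian A a Gamma u lambda) (- u) (- u^T) (0 : 'M[R]_1)
    *m col_mx Delta delta%:M
  = - col_mx (residual A a Gamma u lambda) (2^-1 *: (1%:M - u^T *m u)).

Definition noda_value (R : realType) n (A : 'M[R]_n.+1) (a : 'cV[R]_n.+1)
    (Gamma : R) (u : 'cV[R]_n.+1) : R :=
  vmin (vquot (calA A a Gamma u *m u) u).

(* The step sizes theta k are free positive parameters of the iteration. *)
Definition newton_noda (R : realType) n (A : 'M[R]_n.+1) (a : 'cV[R]_n.+1)
    (Gamma : R) (theta : nat -> R)
    (u : nat -> 'cV[R]_n.+1) (lambda : nat -> R) : Prop :=
  [/\ mx_gt0 (u 0%N),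
      norm2 (u 0%N) = 1,
      lambda 0%N = noda_value A a Gamma (u 0%N) &
      forall k, exists (Delta : 'cV[R]_n.+1) (delta : R),
        [/\ newton_system A a Gamma (u k) (lambda k) Delta delta,
            0 < theta k,
            u k.+1 = let w := u k + theta k *: Delta in (norm2 w)^-1 *: w &
            lambda k.+1 = noda_value A a Gamma (u k.+1)]].

(* Main.v *)
Require Import Defs.
From mathcomp Require Import all_boot all_order all_algebra.
From mathcomp Require Import reals.
From mathcomp Require Import ring lra.
Import Order.TTheory GRing.Theory Num.Theory.
Local Open Scope ring_scope.

(** Since [lambda] is the minimal quotient, the residual [r] is nonnegative,
    and [J u = r + 2 Gamma u^3 / (a + u^2)^2 > 0].  So the Z-matrix [J]
    satisfies [J x > 0 -> x > 0].  The last Newton equation reads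
    [u^T Delta = 0]; were [delta < 0], then [J (- Delta) = r - delta u > 0]
    would give [Delta < 0], a contradiction.  Hence [delta >= 0], so
    [J (u + Delta) = (J u - r) + delta u > 0] and [u + Delta > 0]; the iterate
    is a normalised convex combination of [u] and [u + Delta]. *)

Lemma mx_subE (R : zmodType) m n (M N : 'M[R]_(m, n)) i j :
  (M - N) i j = M i j - N i j.
Proof. by rewrite !mxE. Qed.

(** Compare [x] with [v] at an index [i] where [x i 0 / v i 0] attains its minimum [t]. If [t <= 0],
    then [x - t *: v] is nonnegative and vanishes at [i], and the two signs of entry [i] of its
    image under [J] conflict. *)
Lemma Z_matrix_gt0_inj (R : realType) n (J : 'M[R]_n.+1) (v x : 'cV[R]_n.+1) :
  Z_matrix J -> mx_gt0 v -> mx_gt0 (J *m v) -> mx_gt0 (J *m x) -> mx_gt0 x.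
Proof.
move=> JZ v0 Jv0 Jx0.
have [i _ imin] := @arg_minP _ _ _ (ord0 : 'I_n.+1) predT
  (fun i => x i 0 / v i 0) isT.
set t := x i 0 / v i 0 in imin.
suff t0 : 0 < t.
  by move=> j k; rewrite ord1; have := lt_le_trans t0 (imin j isT);
     rewrite pmulr_lgt0 ?invr_gt0.
rewrite ltNge; apply/negP => t_le0.
have y_ge0 j : 0 <= x j 0 - t * v j 0.
  by rewrite subr_ge0 -ler_pdivlMr //; apply: imin.
have yi : x i 0 - t * v i 0 = 0 by rewrite /t divfK ?subrr // gt_eqF.
(* The diagonal entry of [J], whose sign is unknown, meets the zero coordinate; only off-diagonal
   entries contribute. *)
have : (J *m (x - t *: v)) i 0 <= 0.
  rewrite mxE (bigD1 i) //= !mxE yi mulr0 add0r.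
  apply: sumr_le0 => j ji; rewrite !mxE.
  by apply: mulr_le0_ge0 => //; apply: JZ; rewrite eq_sym.
(* By linearity this entry is that of [J *m x], positive, minus [t] times that of [J *m v], which is
   nonpositive. *)
apply/negP; rewrite -ltNge mulmxBr -scalemxAr.
rewrite mx_subE [X in _ - X]mxE subr_gt0.
by apply: le_lt_trans _ (Jx0 i 0); rewrite mulr_le0_ge0 // ltW.
Qed.

Lemma vmin_le (R : realType) n (v : 'cV[R]_n.+1) i : vmin v <= v i 0.
Proof. by rewrite /vmin (bigD1 i) //= ge_min lexx. Qed.

Lemma norm2_gt0 (R : realType) n (v : 'cV[R]_n.+1) : mx_gt0 v -> 0 < norm2 v.
Proof.
move=> v0; rewrite sqrtr_gt0 (bigD1 ord0) //=.
by rewrite ltr_pwDl ?exprn_gt0 // sumr_ge0 // => i _; rewrite sqr_ge0.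
Qed.

Lemma norm2Z (R : realType) n (c : R) (v : 'cV[R]_n) :
  0 <= c -> norm2 (c *: v) = c * norm2 v.
Proof.
move=> c0; rewrite /norm2.
under eq_bigr do rewrite mxE exprMn.
by rewrite -mulr_sumr sqrtrM ?sqr_ge0 // sqrtr_sqr ger0_norm.
Qed.

Lemma norm2_eq1 (R : realType) n (v : 'cV[R]_n) :
  norm2 v = 1 -> v^T *m v = 1%:M.
Proof.
move=> v1; apply/matrixP => i j; rewrite !ord1 !mxE eqxx /=.
under eq_bigr do rewrite mxE -expr2.
by rewrite -(sqr_sqrtr (sumr_ge0 _ (fun i _ => sqr_ge0 (v i 0))))
  -/(norm2 v) v1 expr1n.
Qed.

Section NewtonStep.

Variables (R : realType) (n : nat).
Variables (A : 'M[R]_n.+1) (a : 'cV[R]_n.+1) (Gamma : R).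
Hypotheses (A_Z : Z_matrix A) (a_gt0 : mx_gt0 a) (Gamma_gt0 : 0 < Gamma).
Variable u : 'cV[R]_n.+1.
Hypothesis u_gt0 : mx_gt0 u.

Let denom_gt0 i : 0 < a i 0 + u i 0 ^+ 2.
Proof. by rewrite addr_gt0 ?exprn_gt0. Qed.

Lemma residual_noda_ge0 : mx_ge0 (residual A a Gamma u (noda_value A a Gamma u)).
Proof.
move=> i j; rewrite ord1 /residual mx_subE [X in _ - X]mxE.
rewrite subr_ge0 -ler_pdivlMr //.
by apply: le_trans (vmin_le _ _ _ i) _; rewrite mxE.
Qed.

Lemma jacobian_Z_matrix lambda : Z_matrix (jacobian A a Gamma u lambda).
Proof.
by move=> i j ij; rewrite !mxE (negbTE ij) !mulr0n mulr0 subr0 addr0 A_Z.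
Qed.

(** All terms linear in [u], including those with [lambda], cancel. What remains is [Gamma] times
    u/(a+u^2) - u(a-u^2)/(a+u^2)^2, entrywise. *)
Lemma jacobian_mul_gt_residual lambda :
  mx_gt0 (jacobian A a Gamma u lambda *m u - residual A a Gamma u lambda).
Proof.
move=> i j; rewrite ord1.
have -> : (jacobian A a Gamma u lambda *m u - residual A a Gamma u lambda) i 0
    = 2 * Gamma * u i 0 ^+ 3 / (a i 0 + u i 0 ^+ 2) ^+ 2.
  rewrite /residual /jacobian /calA mulmxBl !mulmxDl mul_scalar_mx.
  rewrite -!scalemxAl !mul_diag_mx !mxE.
  by field; rewrite gt_eqF.
by rewrite divr_gt0 ?exprn_gt0 ?mulr_gt0 ?exprn_gt0.
Qed.

Lemma newton_full_step_gt0 Delta delta :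
    norm2 u = 1 ->
    newton_system A a Gamma u (noda_value A a Gamma u) Delta delta ->
  mx_gt0 (u + Delta).
Proof.
move=> u1; rewrite /newton_system.
set lambda := noda_value _ _ _ _; set J := jacobian _ _ _ _ _.
set r := residual _ _ _ _ _.
(* Since [u] has unit norm, the last right-hand entry is zero, so the bottom row forces [Delta] to
   be orthogonal to [u]. *)
rewrite mul_block_col opp_col_mx norm2_eq1 // subrr scaler0 oppr0 mul0mx addr0.
rewrite mulNmx mul_mx_scalar => /eq_col_mx[JD /eqP].
rewrite mulNmx oppr_eq0 => /eqP uD.
(* The comparison vector is [u] itself. *)
have J_gt0_inj (x : 'cV_n.+1) : mx_gt0 (J *m x) -> mx_gt0 x.
  move=> Jx; apply: (Z_matrix_gt0_inj _ _ J u) => // [|i j].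
    exact: jacobian_Z_matrix.
  have := jacobian_mul_gt_residual lambda i j.
  rewrite mx_subE subr_gt0.
  exact: le_lt_trans (residual_noda_ge0 i j).
have JDE : J *m Delta = delta *: u - r by rewrite addrC -JD addrNK.
have delta_ge0 : 0 <= delta.
  rewrite leNgt; apply/negP => delta_lt0.
  have ND_gt0 : mx_gt0 (- Delta).
    apply: J_gt0_inj => i j; rewrite mulmxN JDE opprB.
    rewrite -scaleNr mxE ltr_wpDl ?residual_noda_ge0 //.
    by rewrite mxE mulr_gt0 ?oppr_gt0.
  have : 0 < (u^T *m - Delta) 0 0.
    have uD_gt0 i : 0 < u^T 0 i * (- Delta) i 0 by rewrite mxE mulr_gt0.
    rewrite mxE (bigD1 ord0) //= ltr_pwDl //.
    by apply: sumr_ge0 => i _; apply: ltW.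
  by rewrite mulmxN uD oppr0 mxE ltxx.
apply: J_gt0_inj => i j; rewrite mulmxDr JDE addrCA.
rewrite mxE ltr_wpDl ?jacobian_mul_gt_residual //.
by rewrite mxE mulr_ge0 // ltW.
Qed.

End NewtonStep.

Theorem theorem2p2 (R : realType) (n : nat)
    (A : 'M[R]_n.+1) (a : 'cV[R]_n.+1) (Gamma : R)
    (theta : nat -> R) (u : nat -> 'cV[R]_n.+1) (lambda : nat -> R)
    (A_irreducible : irreducible_mx A)
    (A_M_matrix : nonsingular_M_matrix A)
    (a_gt0 : mx_gt0 a)
    (Gamma_gt0 : 0 < Gamma)
    (u_lambda_NNI : newton_noda A a Gamma theta u lambda)
    (theta_bounds : forall k, 0 < theta k <= 1) :
  forall k, mx_gt0 (u k).
Proof.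
case: A_M_matrix => A_Z _ _; case: u_lambda_NNI => u0 u01 l0 step.
(* The induction also carries the unit norm, which gives orthogonality, and the Noda value, which
   gives a nonnegative residual. *)
suff H k : [/\ mx_gt0 (u k), norm2 (u k) = 1
             & lambda k = noda_value A a Gamma (u k)] by move=> k; case: (H k).
elim: k => [//|k [uk_gt0 uk1 lk]].
have [Delta [delta [newton theta_gt0 uE ->]]] := step k.
rewrite lk in newton.
have full_gt0 := newton_full_step_gt0 _ _ _ _ _ A_Z a_gt0 Gamma_gt0 _ uk_gt0
  _ _ uk1 newton.
(* With t = [theta k], the vector is (1-t) [u k] + t ([u k + Delta]); the bound t <= 1 keeps the
   first weight nonnegative. *)
have w_gt0 : mx_gt0 (u k + theta k *: Delta).
  move=> i j; have := full_gt0 i j; have := uk_gt0 i j; rewrite !mxE.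
  have /andP[t0 t1] := theta_bounds k; nra.
have nw_gt0 := norm2_gt0 _ _ _ w_gt0.
rewrite uE; split=> //.
  by move=> i j; rewrite mxE mulr_gt0 ?invr_gt0.
by rewrite norm2Z ?mulVf ?gt_eqF // invr_ge0 ltW.
Qed.
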